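(* For every real $\delta>0$ there exists an integer $K'(\delta)\geq1$ such that every $E\subseteq\mathbb{Z}^2$ with $d^\star(E)\geq\delta$ satisfies $$K'(\delta)\mathbb{Z}\subseteq\{x^2-y^2:(x,y)\in E-E\}.$$
   Context: For $E\subseteq\mathbb{Z}^2$, $E-E=\{u-v:u,v\in E\}$. The upper Banach density of $A\subseteq\mathbb{Z}^2$ is $$d^\star(A):=\lim_{N\to\infty}\sup_{z\in\mathbb{Z}^2}\frac{|A\cap(z+[-N,N]^2)|}{(2N+1)^2},$$ where $[-N,N]^2$ denotes the set of integer points in that square. *)

(* Defs.v *)
From HB Require Import structures.
From mathcomp Require Import all_boot all_order all_algebra.
From mathcomp Require Import finmap.
From mathcomp Require Import all_classical all_reals all_analysis.
Set Implicit Arguments.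
Unset Strict Implicit.
Unset Printing Implicit Defensive.
Import Order.TTheory GRing.Theory Num.Theory.
Import numFieldNormedType.Exports.
Local Open Scope classical_set_scope.
Local Open Scope ring_scope.

Definition difference_set (E : set (int * int)) : set (int * int) :=
  [set u - v | u in E & v in E].

Definition square_box (N : nat) : set (int * int) :=
  [set w | (- N%:Z <= w.1 <= N%:Z) /\ (- N%:Z <= w.2 <= N%:Z)].

Definition translate (z : int * int) (B : set (int * int)) : set (int * int) :=
  [set z + w | w in B].

(* [fset_set] returns the empty finite set on infinite sets; here it is only
   applied to subsets of a finite box, so this is the true cardinality. *)
Definition box_count (A : set (int * int)) (N : nat) (z : int * int) : nat :=
  #|` fset_set (A `&` translate z (square_box N)) |%fset.

(* The suprema are over nonempty sets of reals contained in [0, 1]. *)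
Definition upper_banach_density (R : realType) (A : set (int * int)) : R :=
  limn (fun N : nat =>
    sup (range (fun z : int * int =>
      (box_count A N z)%:R / ((2 * N + 1) ^ 2)%N%:R : R))).

(* Main.v *)
Require Import Defs.
From HB Require Import structures.
From mathcomp Require Import all_boot all_order all_algebra.
From mathcomp Require Import finmap.
From mathcomp Require Import all_classical all_reals all_analysis.
From mathcomp Require Import ring lra zify.
Import Order.TTheory GRing.Theory Num.Theory.
Import numFieldNormedType.Exports.
Local Open Scope classical_set_scope.
Local Open Scope ring_scope.

(** Why the theorem is true.

    In the coordinates X = x + m y, Y = m y - x one has X^2 - Y^2 = 4 m x y,
    so it suffices to find, for K = 4 Lam k, a difference of E coming from a
    point (s x, s' y) with s s' = Lam and x y = k.  The hyperbolas x y = const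
    are preserved by the dilations (x, y) |-> (t x, y / t), and these form an
    amenable group; this is the only symmetry that is used.

    Suppose that no such difference exists.  Let A be the part of E inside a
    huge box where E has density about delta, and let h (x, y) be the
    normalised autocorrelation of A at (x + m y, m y - x).  By Cauchy-Schwarz,
    h - kappa is still positive semidefinite for a kappa depending on delta
    only ([dense_sample]): subtracting kappa removes the part of A that
    correlates with constants.  Averaging h over the dilations (s, Lam / s),
    with s a product of small integers, yields a positive semidefinite kernel
    G that is almost invariant, G (t x, y) ~ G (x, t y) for every small t
    ([dilation_average]), and equal to - kappa on the hyperbola x y = k.

    Such a kernel does not exist ([no_hyperbolic_kernel]).  Invariance gives
    G (x, y) ~ g (x y) for y <> 0, where g q = G (q, 1), and G (x, 0) ~ a for
    every x <> 0.  View G (p - p') as the inner product of vectors e_p and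
    e_p'.  The vectors e_(q, 0) have constant inner products a, so the averages
    of e_(q, 0) over two large sets of integers q nearly coincide; pairing
    with e_(0, -1) shows that the average of g over any large set of
    integers is nearly one constant b ([avg_product_line]).  Now the points
    (2^i, 2^(n - i)) on the hyperbola x y = 2^n, and likewise the comparison
    points (-j, -j), have differences whose products x y hardly ever repeat.
    Hence all averaged inner products within and between the two families are
    about b, so b >= 0 up to a small error and the two averages of vectors
    nearly coincide.  But their inner products with e_(0, 0) are - kappa for
    the first family and about b for the second: a contradiction. *)

(** * Positive semidefinite kernels almost invariant under hyperbolic dilations *)

(** G stands for a translation-invariant Gram kernel (p, p') |-> G (p - p') on
    the lattice.  Both bounds M and B are needed because G comes from a finite
    sample and a finite family of dilations: positivity is only available for
    points in a box of radius M, and invariance only for multipliers up to B. *)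
Record hyperbolic_kernel {R : realFieldType} (eta : R) (M : int) (B : nat)
    (G : int -> int -> R) : Prop := HyperbolicKernel {
  hk_ge : forall x y, - 1 <= G x y;
  hk_le : forall x y, G x y <= G 0 0;
  hk_le1 : G 0 0 <= 1;
  hk_even : forall x y, G (- x) (- y) = G x y;
  hk_dil : forall (m : nat) x y, (0 < m <= B)%N ->
    `|G (m%:Z * x) y - G x (m%:Z * y)| <= eta;
  hk_psd : forall (I : finType) (c : I -> R) (x y : I -> int),
    (forall i, `|x i| <= M) -> (forall i, `|y i| <= M) ->
    0 <= \sum_i \sum_j c i * c j * G (x i - x j) (y i - y j) }.

Arguments hk_ge {R eta M B G}.
Arguments hk_le {R eta M B G}.
Arguments hk_le1 {R eta M B G}.
Arguments hk_even {R eta M B G}.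
Arguments hk_dil {R eta M B G}.
Arguments hk_psd {R eta M B G}.

Definition avg {R : realFieldType} {n : nat} (F : 'I_n -> R) : R :=
  (\sum_i F i) / n%:R.

Lemma avg_eq {R : realFieldType} {n : nat} (F F' : 'I_n -> R) :
  (forall i, F i = F' i) -> avg F = avg F'.
Proof. by move=> e; rewrite /avg; under eq_bigr do rewrite e. Qed.

Lemma avg_le {R : realFieldType} {n : nat} (F F' : 'I_n -> R) :
  (forall i, F i <= F' i) -> avg F <= avg F'.
Proof.
move=> e; rewrite /avg ler_wpM2r ?invr_ge0 ?ler0n //.
by apply: ler_sum => i _; apply: e.
Qed.

Lemma avgD {R : realFieldType} {n : nat} (F F' : 'I_n -> R) :
  avg (fun i => F i + F' i) = avg F + avg F'.
Proof. by rewrite /avg big_split mulrDl. Qed.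

Lemma avgZ {R : realFieldType} {n : nat} (a : R) (F : 'I_n -> R) :
  avg (fun i => a * F i) = a * avg F.
Proof. by rewrite /avg -mulr_sumr mulrA. Qed.

Lemma avgB {R : realFieldType} {n : nat} (F F' : 'I_n -> R) :
  avg (fun i => F i - F' i) = avg F - avg F'.
Proof. by rewrite /avg sumrB mulrBl. Qed.

Lemma avg_const {R : realFieldType} {n : nat} (c : R) : (0 < n)%N -> avg (fun _ : 'I_n => c) = c.
Proof.
move=> n0; rewrite /avg sumr_const card_ord -[c *+ n]mulr_natr mulfK //.
by rewrite pnatr_eq0 -lt0n.
Qed.

Lemma avg_exchange {R : realFieldType} {n : nat} (F : 'I_n -> 'I_n -> R) :
  avg (fun i => avg (F i)) = avg (fun j => avg (F^~ j)).
Proof. by rewrite /avg -!mulr_suml exchange_big. Qed.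

(** The squared length of l e_o + (mean of e_p) - (mean of e_p') for two
    families of points p and p', where e denotes the vectors with Gram kernel G.
    Every use of positivity to compare two averages is an instance. *)
Lemma psd_two_families {R : realFieldType} {eta : R} {M B G}
    (hG : hyperbolic_kernel eta M B G) {n : nat} (l : R) (ox oy : int)
    (x y x' y' : 'I_n -> int) :
  `|ox| <= M -> `|oy| <= M ->
  (forall i, `|x i| <= M) -> (forall i, `|y i| <= M) ->
  (forall i, `|x' i| <= M) -> (forall i, `|y' i| <= M) ->
  0 <= l ^+ 2 * G 0 0
       + 2 * l * (avg (fun i => G (x i - ox) (y i - oy))
                  - avg (fun i => G (x' i - ox) (y' i - oy)))
       + avg (fun i => avg (fun j => G (x i - x j) (y i - y j)))
       + avg (fun i => avg (fun j => G (x' i - x' j) (y' i - y' j)))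
       - 2 * avg (fun i => avg (fun j => G (x i - x' j) (y i - y' j))).
Proof.
move=> hox hoy hx hy hx' hy'.
pose I : finType := ('I_1 + ('I_n + 'I_n))%type.
pose c (i : I) : R := match i with inl _ => l | inr (inl _) => n%:R^-1
  | inr (inr _) => - n%:R^-1 end.
pose X (i : I) := match i with inl _ => ox | inr (inl i) => x i
  | inr (inr i) => x' i end.
pose Y (i : I) := match i with inl _ => oy | inr (inl i) => y i
  | inr (inr i) => y' i end.
have hX i : `|X i| <= M by case: i => [i|[i|i]] /=.
have hY i : `|Y i| <= M by case: i => [i|[i|i]] /=.
have := hk_psd hG I c X Y hX hY.
have E (F : I -> R) : \sum_i c i * F i = l * F (inl ord0)
    + avg (fun i => F (inr (inl i))) - avg (fun i => F (inr (inr i))).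
  rewrite big_sumType big_ord1 big_sumType /= -!mulr_sumr /avg.
  by rewrite mulNr addrA ![_ / n%:R]mulrC.
under eq_bigr do under eq_bigr do rewrite -mulrA.
under eq_bigr do rewrite -mulr_sumr E.
rewrite E /= !avgB !avgD !avgZ !subrr.
rewrite (avg_exchange (fun i j => G (x' i - x j) (y' i - y j))).
have sym a b a' b' : G (a - a') (b - b') = G (a' - a) (b' - b).
  by rewrite -(hk_even hG) !opprB.
under [avg (fun i => G (ox - x i) _)]avg_eq do rewrite sym.
under [avg (fun i => G (ox - x' i) _)]avg_eq do rewrite sym.
under [avg (fun j => avg (fun i => G (x' i - x j) _))]avg_eq do
  under avg_eq do rewrite sym.
by move=> h; apply: le_trans h _; rewrite le_eqVlt; apply/orP; left; apply/eqP; ring.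
Qed.

(** * Equidistribution of the values of an invariant kernel *)

(** Multipliers transport G (1, 0) to G (m, 0), since they fix the second
    coordinate 0.  At the origin only the bounds on G remain, whence the
    indicator term. *)
Lemma hk_axis {R : realFieldType} {eta : R} {M B G}
    (hG : hyperbolic_kernel eta M B G) (x : int) : 0 <= eta -> `|x| <= B%:Z ->
  G 1 0 - eta <= G x 0 <= G 1 0 + eta + 2 * (x == 0)%:R.
Proof.
move=> eta0 hx.
have pos (m : nat) : (0 < m <= B)%N -> `|G m 0 - G 1 0| <= eta.
  by move=> hm; have := hk_dil hG m 1 0 hm; rewrite mulr1 mulr0.
have [->|x0] := eqVneq x 0.
  have := hk_le hG 1 0; have := hk_ge hG 1 0; have := hk_le1 hG; rewrite /=; lra.
have -> : G x 0 = G `|x|%N 0.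
  by case: x {hx x0} => m //; rewrite NegzE -[RHS](hk_even hG) oppr0.
have : (0 < `|x| <= B)%N by lia.
by move/pos; rewrite ler_norml /= mulr0 addr0; lra.
Qed.

(** Invariance moves the whole factor v to the first coordinate; evenness
    takes care of negative v. *)
Lemma hk_product {R : realFieldType} {eta : R} {M B G}
    (hG : hyperbolic_kernel eta M B G) (u v : int) : 0 <= eta -> `|v| <= B%:Z ->
  `|G u v - G (u * v) 1| <= eta + 2 * (v == 0)%:R.
Proof.
move=> eta0 hv.
have bd a b : - 1 <= G a b <= 1.
  by rewrite (hk_ge hG) (le_trans (hk_le hG a b) (hk_le1 hG)).
have [->|v0] := eqVneq v 0.
  by rewrite ler_norml /=; have := bd u 0; have := bd (u * 0) 1; lra.
have pos (m : nat) a : (0 < m <= B)%N -> `|G a m - G (a * m) 1| <= eta.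
  by move=> hm; have := hk_dil hG m a 1 hm; rewrite mulr1 distrC mulrC.
rewrite mulr0 addr0.
case: v hv v0 => m hv v0; first by apply: pos; lia.
rewrite NegzE -(hk_even hG u) opprK mulrN -mulNr; apply: pos.
by lia.
Qed.

Lemma avg_coll {R : realFieldType} {n : nat} (q : 'I_n -> int) (a : int) (k : nat) :
  (#|[pred j | q j == a]| <= k)%N ->
  avg (fun j => (q j == a)%:R : R) <= k%:R / n%:R.
Proof.
move=> h; rewrite /avg ler_wpM2r ?invr_ge0 ?ler0n //.
rewrite -natr_sum ler_nat; apply: leq_trans h.
by rewrite -sum1_card [X in (_ <= X)%N]big_mkcond /= leq_sum // => i _; rewrite inE; case: eqP.
Qed.

(** For the point families used below and a fixed i, the product
    (x_i - x_j) (y_i - y_j) can take the same value at j and at 2 i - j, so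
    injectivity in j is too much to ask. *)
Definition two_to_one {n : nat} (q : 'I_n -> int) :=
  forall i, (#|[pred j | q j == q i]| <= 2)%N.

Lemma avg_gram_axis {R : realFieldType} {eta : R} {M B : nat} {G}
    (hG : hyperbolic_kernel eta M B G) (n : nat) (q : 'I_n -> int) :
  0 <= eta -> (0 < n)%N -> (2 * M <= B)%N -> two_to_one q ->
  (forall i, `|q i| <= M%:Z) ->
  avg (fun i => avg (fun j => G (q i - q j) 0)) <= G 1 0 + eta + 4 / n%:R.
Proof.
move=> eta0 n0 MB h2 hq.
rewrite -[leRHS](avg_const (n:=n)) //; apply: avg_le => i.
apply: (@le_trans _ _ (avg (fun j => G 1 0 + eta + 2 * (q j == q i)%:R))).
  apply: avg_le => j; rewrite [q j == _]eq_sym -subr_eq0.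
  have hB : `|q i - q j| <= B%:Z by have := hq i; have := hq j; lia.
  by have /andP[] := hk_axis hG _ eta0 hB.
rewrite avgD avgZ avg_const //.
by have := @avg_coll R _ q (q i) _ (h2 i); lra.
Qed.

(** The two means of the vectors e_(q, 0) nearly coincide: off the few
    coincidences all their inner products are close to G (1, 0).  Pairing their
    difference with e_(0, -1) bounds the difference of the means of G (q, 1).
    The multiplier l = - d is the one that minimises the quadratic form. *)
Lemma avg_product_line {R : realFieldType} {eta rho : R} {M B : nat} {G}
    (hG : hyperbolic_kernel eta M B G) (n : nat) (q q' : 'I_n -> int) :
  0 <= eta -> 0 <= rho -> (0 < n)%N -> (0 < M)%N -> (2 * M <= B)%N ->
  8 / n%:R + 4 * eta <= rho ^+ 2 ->
  two_to_one q -> two_to_one q' ->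
  (forall i, `|q i| <= M%:Z) -> (forall i, `|q' i| <= M%:Z) ->
  `|avg (fun i => G (q i) 1) - avg (fun i => G (q' i) 1)| <= rho.
Proof.
move=> eta0 rho0 n0 M0 MB hrho h2 h2' hq hq'.
set d := _ - _.
have h0 (i : 'I_n) : `|0 : int| <= M%:Z by lia.
have := @psd_two_families R eta M B G hG n (- d) 0 (-1) q (fun=> 0) q' (fun=> 0).
have -> : avg (fun i => G (q i - 0) (0 - -1)) = avg (fun i => G (q i) 1).
  by apply: avg_eq => i; rewrite subr0 sub0r opprK.
have -> : avg (fun i => G (q' i - 0) (0 - -1)) = avg (fun i => G (q' i) 1).
  by apply: avg_eq => i; rewrite subr0 sub0r opprK.
rewrite -/d subr0.
have /= := avg_gram_axis hG n q eta0 n0 MB h2 hq.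
have /= := avg_gram_axis hG n q' eta0 n0 MB h2' hq'.
have : G 1 0 - eta <= avg (fun i => avg (fun j => G (q i - q' j) 0)).
  rewrite -[leLHS](avg_const (n:=n)) //; apply: avg_le => i.
  rewrite -[leLHS](avg_const (n:=n)) //; apply: avg_le => j.
  have hB : `|q i - q' j| <= B%:Z by have := hq i; have := hq' j; lia.
  by have /andP[] := hk_axis hG _ eta0 hB.
move=> A1 A2 A3 A4.
have {}A4 := A4 ltac:(lia) ltac:(lia) hq h0 hq' h0.
have A5 : d ^+ 2 * G 0 0 <= d ^+ 2 by rewrite ler_piMr ?sqr_ge0 ?(hk_le1 hG).
clear h0.
rewrite -(ler_pXn2r (n:=2)) ?nnegrE // real_normK ?num_real //.
rewrite sqrrN in A4; lra.
Qed.

(** Any family of n distinct integers would serve as reference; the squares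
    are the products of the comparison points (-j, -j) of the final argument. *)
Definition square_avg {R : realFieldType} (n : nat) (G : int -> int -> R) : R :=
  avg (fun j : 'I_n => G (j.+1%:Z ^+ 2) 1).

Lemma avg_product {R : realFieldType} {eta rho : R} {M B : nat} {G}
    (hG : hyperbolic_kernel eta M B G) (n : nat) (u v : 'I_n -> int) :
  0 <= eta -> 0 <= rho -> (0 < n)%N -> (n * n <= M)%N -> (2 * M <= B)%N ->
  8 / n%:R + 4 * eta <= rho ^+ 2 ->
  two_to_one (fun i => u i * v i) -> (#|[pred j | v j == 0%Z]| <= 1)%N ->
  (forall i, `|u i * v i| <= M%:Z) -> (forall i, `|v i| <= M%:Z) ->
  `|avg (fun i => G (u i) (v i)) - square_avg n G| <= rho + eta + 2 / n%:R.
Proof.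
move=> eta0 rho0 n0 nM MB hrho h2 hv0 huv hv.
have sqM (i : 'I_n) : `|i.+1%:Z ^+ 2| <= M%:Z.
  rewrite ger0_norm ?sqr_ge0 // expr2 -PoszM lez_nat.
  by apply: leq_trans nM; apply: leq_mul; apply: ltn_ord.
have sq2 : two_to_one (fun i : 'I_n => i.+1%:Z ^+ 2).
  move=> i; apply: (@leq_trans 1) => //; rewrite -(card1 i); apply: subset_leq_card.
  by apply/fintype.subsetP => j; rewrite !inE eqrXn2 ?lez_nat // => /eqP[e]; apply/eqP/val_inj.
have A1 := avg_product_line hG n _ _ eta0 rho0 n0 ltac:(lia) MB hrho h2 sq2 huv sqM.
rewrite -/(square_avg n G) in A1.
have A2 : `|avg (fun i => G (u i) (v i)) - avg (fun i => G (u i * v i) 1)|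
          <= eta + 2 / n%:R.
  have pt i : - (eta + 2 * (v i == 0)%:R) <= G (u i) (v i) - G (u i * v i) 1
      <= eta + 2 * (v i == 0)%:R.
    by rewrite -ler_norml; apply: (hk_product hG) => //; have := hv i; lia.
  have := @avg_coll R _ v 0 _ hv0; rewrite -avgB ler_norml.
  have : avg (fun i => eta + 2 * (v i == 0)%:R) = eta + 2 * avg (fun i => (v i == 0)%:R).
    by rewrite avgD avgZ avg_const.
  have /= := avg_le _ _ (fun i => proj1 (andP (pt i))).
  have /= := avg_le _ _ (fun i => proj2 (andP (pt i))).
  have -> : avg (fun i => - (eta + 2 * (v i == 0)%:R)) =
    - avg (fun i => eta + 2 * (v i == 0)%:R).
    by rewrite /avg sumrN mulNr.
  by lra.
move: A1 A2; rewrite !ler_norml; lra.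
Qed.

(** * No invariant kernel is negative on a hyperbola *)

Lemma two_to_one_sum {n : nat} (s : nat) (q : 'I_n -> int) :
  (forall j j' : 'I_n, q j = q j' -> j = j' \/ (j + j' = s)%N) -> two_to_one q.
Proof.
move=> h i; rewrite cardE -(size_map val).
apply: (@uniq_leq_size _ _ [:: val i; s - i]%N).
  by rewrite map_inj_uniq ?enum_uniq //; apply: val_inj.
move=> _ /mapP[j + ->]; rewrite mem_enum !inE => /eqP/h [->|<-]; first by rewrite eqxx.
by rewrite addnK eqxx orbT.
Qed.

Lemma card_zero_le1 {n : nat} (i : 'I_n) (v : 'I_n -> int) :
  (forall j, v j = 0 -> j = i) -> (#|[pred j | v j == 0%Z]| <= 1)%N.
Proof.
move=> h; rewrite -(card1 i); apply: subset_leq_card.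
by apply/fintype.subsetP => j; rewrite !inE => /eqP/h ->.
Qed.

(** With a a' = b b' = c c' = 2^n for the three points, equality of the two
    products forces a b' + b a' = a c' + c a', hence
    (a b' - a c') (a b' - c a') = 0: a pair of numbers is determined by its sum
    and its product. *)
Lemma hyperbola_collision {n : nat} (i j j' : 'I_n) :
  ((2 ^ i)%N%:Z - (2 ^ j)%N%:Z) * ((2 ^ (n - i))%N%:Z - (2 ^ (n - j))%N%:Z) =
  ((2 ^ i)%N%:Z - (2 ^ j')%N%:Z) * ((2 ^ (n - i))%N%:Z - (2 ^ (n - j'))%N%:Z) ->
  j = j' \/ (j + j' = i + i)%N.
Proof.
have prod (m : 'I_n) : (2 ^ m)%N%:Z * (2 ^ (n - m))%N%:Z = (2 ^ n)%N%:Z.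
  by rewrite -PoszM -expnD subnKC // ltnW.
have hi := prod i; have hj := prod j; have hj' := prod j'.
have e2 (a b : nat) : (2 ^ a)%N%:Z = (2 ^ b)%N%:Z -> a = b.
  by case=> /eqP; rewrite eqn_exp2l // => /eqP.
have := ltn_ord i; have := ltn_ord j; have := ltn_ord j'.
have M2 (m m' : nat) : (2 ^ m)%N%:Z * (2 ^ m')%N%:Z = (2 ^ (m + m'))%N%:Z.
  by rewrite -PoszM expnD.
have p2 : (2 ^ i)%N%:Z != 0 by rewrite eqz_nat expn_eq0.
move=> lj' lj li e.
have : (2 ^ i)%N%:Z * ((2 ^ (n - j))%N%:Z - (2 ^ (n - j'))%N%:Z) *
       ((2 ^ i)%N%:Z * (2 ^ (n - j))%N%:Z - (2 ^ j')%N%:Z * (2 ^ (n - i))%N%:Z) = 0.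
  move: e hi hj hj'; move: (2 ^ i)%N%:Z (2 ^ j)%N%:Z (2 ^ j')%N%:Z (2 ^ n)%N%:Z
    (2 ^ (n - i))%N%:Z (2 ^ (n - j))%N%:Z (2 ^ (n - j'))%N%:Z => a b c k a' b' c' e ha hb hc.
  have E : a * b' + b * a' = a * c' + c * a'.
    have : (a - b) * (a' - b') = a * a' + b * b' - (a * b' + b * a') by ring.
    have : (a - c) * (a' - c') = a * a' + c * c' - (a * c' + c * a') by ring.
    by rewrite ha hb hc; lia.
  have -> : a * (b' - c') * (a * b' - c * a') =
     a * b' * (a * b') - a * b' * (a * c' + c * a') + (a * a') * (c * c') by ring.
  by rewrite -E ha hc -{1}ha -hb; ring.
move/eqP; rewrite !mulf_eq0 (negPf p2) /= !subr_eq0 => /orP[/eqP/e2 h|/eqP].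
  by left; apply: val_inj => /=; lia.
by rewrite !M2 => /e2; right; lia.
Qed.

Lemma avg_gram_ge0 {R : realFieldType} {eta : R} {M B G}
    (hG : hyperbolic_kernel eta M B G) (n : nat) (x y : 'I_n -> int) :
  (forall i, `|x i| <= M) -> (forall i, `|y i| <= M) ->
  0 <= avg (fun i => avg (fun j => G (x i - x j) (y i - y j))).
Proof.
move=> hx hy; have := hk_psd hG _ (fun=> n%:R^-1) x y hx hy.
congr (0 <= _); rewrite /avg mulr_suml; apply: eq_bigr => i _.
by rewrite -mulr_sumr mulrC mulrA.
Qed.

Lemma sub_bound (K a b : int) : - K <= a <= K -> - K <= b <= K -> `|a - b| <= 2 * K.
Proof. lia. Qed.

Lemma product_bound (K : nat) (u v : int) : (0 < K)%N ->
  `|u| <= 2 * K%:Z -> `|v| <= 2 * K%:Z ->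
  `|u * v| <= (4 * (K * K))%N%:Z /\ `|v| <= (4 * (K * K))%N%:Z.
Proof.
move=> K0; have -> : (4 * (K * K))%N%:Z = (2 * K%:Z) * (2 * K%:Z) by lia.
by move=> hu hv; rewrite normrM; split; [apply: ler_pM | nia].
Qed.

Lemma ascending_collision (a b : int) (j j' : nat) : 0 <= a -> 0 <= b ->
  (a + j.+1%:Z) * (b + j.+1%:Z) = (a + j'.+1%:Z) * (b + j'.+1%:Z) -> j = j'.
Proof. nia. Qed.

(** The mean of the vectors e_p over the hyperbola points and the mean over
    the diagonal points have averaged inner products close to b, hence are close to
    each other; their inner products with e_(0, 0), namely - kappa and about
    b >= 0, are not. *)
Lemma no_hyperbolic_kernel {R : archiRealFieldType} (kappa : R) :
  0 < kappa <= 1 ->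
  exists k L M B : nat, [/\ (0 < k)%N, (0 < L)%N &
    forall G, hyperbolic_kernel (L%:R^-1) M B G ->
      ~ (forall x y : int, x * y = k%:Z -> G x y = - kappa)].
Proof.
move=> /andP[k0 k1].
(* All errors below add up to less than 30 rho = kappa ^ 2. *)
pose rho := kappa ^+ 2 / 30.
have rho0 : 0 < rho by rewrite divr_gt0 // exprn_gt0.
have [n nrho] : exists n : nat, 12 / rho ^+ 2 < n%:R.
  by exists (Num.bound (12 / rho ^+ 2)); rewrite archi_boundP // divr_ge0 // sqr_ge0.
have n0 : (0 < n)%N.
  by case: n nrho => //; rewrite ltNge divr_ge0 // sqr_ge0.
exists (2 ^ n)%N, n, (4 ^ n.+1)%N, (2 * 4 ^ n.+1)%N; split=> //; first by rewrite expn_gt0.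
move=> G hG hk.
set M := (4 ^ n.+1)%N in hG.
have nlt : (n < 2 ^ n)%N by rewrite ltn_expl.
have ME : M = (4 * (2 ^ n * 2 ^ n))%N.
  by rewrite /M expnS -expnMn.
have Mbig : (n * n <= M)%N by rewrite ME; nia.
have nR0 : 0 < n%:R :> R by rewrite ltr0n.
have ninv : n%:R^-1 <= rho ^+ 2 / 12 :> R.
  by rewrite -[leRHS]invrK lef_pV2 ?posrE ?invf_div ?(ltW nrho) ?divr_gt0 ?exprn_gt0.
have ninv0 : 0 <= n%:R^-1 :> R by rewrite invr_ge0 ltW.
have rho1 : rho <= 1 by rewrite /rho; nra.
have ninvr : n%:R^-1 <= rho / 12 :> R by nra.
have hrho : 8 / n%:R + 4 * n%:R^-1 <= rho ^+ 2 :> R by lra.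
pose b := square_avg n G.
pose X (i : 'I_n) := (2 ^ i)%N%:Z.
pose Y (i : 'I_n) := (2 ^ (n - i))%N%:Z.
pose Z (j : 'I_n) : int := - j.+1%:Z.
have key u v := avg_product hG n u v ninv0 (ltW rho0) n0 Mbig (leqnn _) hrho.
have K0 : (0 < 2 ^ n)%N by rewrite expn_gt0.
have bX i : - (2 ^ n)%N%:Z <= X i <= (2 ^ n)%N%:Z.
  by rewrite (@le_trans _ _ 0) ?oppr_le0 //= /X lez_nat leq_exp2l //= ltnW.
have bY i : - (2 ^ n)%N%:Z <= Y i <= (2 ^ n)%N%:Z.
  by rewrite (@le_trans _ _ 0) ?oppr_le0 //= /Y lez_nat leq_exp2l //= leq_subr.
have bZ i : - (2 ^ n)%N%:Z <= Z i <= (2 ^ n)%N%:Z.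
  rewrite lerN2 lez_nat (leq_trans (ltn_ord i) (ltnW nlt)) /=.
  by rewrite (@le_trans _ _ 0) ?oppr_le0.
have row (a b' : int) (u v : 'I_n -> int) :
    - (2 ^ n)%N%:Z <= a <= (2 ^ n)%N%:Z -> - (2 ^ n)%N%:Z <= b' <= (2 ^ n)%N%:Z ->
    (forall j, - (2 ^ n)%N%:Z <= u j <= (2 ^ n)%N%:Z) ->
    (forall j, - (2 ^ n)%N%:Z <= v j <= (2 ^ n)%N%:Z) ->
    two_to_one (fun j => (a - u j) * (b' - v j)) ->
    (#|[pred j | (b' - v j)%R == 0%Z]| <= 1)%N ->
    `|avg (fun j => G (a - u j) (b' - v j)) - b| <= rho + n%:R^-1 + 2 / n%:R.
  move=> ha hb hu hv h2 hz.
  have bd j := product_bound _ _ _ K0 (sub_bound _ _ _ ha (hu j)) (sub_bound _ _ _ hb (hv j)).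
  by apply: key => // j; rewrite ME; case: (bd j).
(* The first family runs along the hyperbola, the second along the diagonal. *)
have row11 i : `|avg (fun j => G (X i - X j) (Y i - Y j)) - b| <= rho + n%:R^-1 + 2 / n%:R.
  apply: row => //.
    by apply: (@two_to_one_sum n (i + i)) => j j' /hyperbola_collision.
  apply: (card_zero_le1 i) => j /eqP; rewrite subr_eq0 eqz_nat eqn_exp2l // => /eqP h.
  by apply: val_inj; rewrite -[LHS](subKn (ltnW (ltn_ord j))) -h subKn // ltnW.
have row22 i : `|avg (fun j => G (Z i - Z j) (Z i - Z j)) - b| <= rho + n%:R^-1 + 2 / n%:R.
  apply: row => //.
    apply: (@two_to_one_sum n (i + i)) => j j' /eqP; rewrite -!expr2 eqf_sqr /Z.
    case/orP=> /eqP h; [left; apply: val_inj => /=|right]; move: h; clear; lia.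
  apply: (card_zero_le1 i) => j /eqP; rewrite subr_eq0 /Z => h.
  by apply: val_inj => /=; move: h; clear; lia.
have row12 i : `|avg (fun j => G (X i - Z j) (Y i - Z j)) - b| <= rho + n%:R^-1 + 2 / n%:R.
  apply: row => //.
    apply: (@two_to_one_sum n (i + i)) => j j' h; left; apply: val_inj.
    by apply: (ascending_collision (X i) (Y i)) => //; move: h; rewrite /Z !opprK.
  apply: (card_zero_le1 i) => j /eqP; rewrite opprK.
  by rewrite gt_eqF // ltr_wpDl.
(* G (-j, -j) is compared with G (j ^ 2, 1), the reference value of b. *)
have diag : b - n%:R^-1 <= avg (fun j => G (Z j - 0) (Z j - 0)).
  rewrite /b /square_avg -[X in _ - X](avg_const (n := n)) // -avgB; apply: avg_le => j.
  have := hk_dil hG j.+1 j.+1%:Z 1; rewrite mulr1 -expr2 !subr0 /Z (hk_even hG) ler_norml.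
  have -> : (0 < j.+1 <= 2 * M)%N by have := ltn_ord j; rewrite ME; nia.
  by move/(_ isT); lra.
have hyp : avg (fun j => G (X j - 0) (Y j - 0)) = - kappa.
  rewrite -[RHS](avg_const (n := n)) //; apply: avg_eq => j.
  by rewrite !subr0 hk // /X /Y -PoszM -expnD subnKC // ltnW.
pose c := rho + n%:R^-1 + 2 / n%:R.
have sum11 : avg (fun i => avg (fun j => G (X i - X j) (Y i - Y j))) <= b + c.
  rewrite -[leRHS](avg_const (n := n)) //; apply: avg_le => i.
  by have := row11 i; rewrite ler_norml /c; lra.
have sum22 : avg (fun i => avg (fun j => G (Z i - Z j) (Z i - Z j))) <= b + c.
  rewrite -[leRHS](avg_const (n := n)) //; apply: avg_le => i.
  by have := row22 i; rewrite ler_norml /c; lra.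
have sum12 : b - c <= avg (fun i => avg (fun j => G (X i - Z j) (Y i - Z j))).
  rewrite -[leLHS](avg_const (n := n)) //; apply: avg_le => i.
  by have := row12 i; rewrite ler_norml /c; lra.
have inM (x : int) : - (2 ^ n)%N%:Z <= x <= (2 ^ n)%N%:Z -> `|x| <= M%:Z.
  by rewrite -ler_norml => /le_trans; apply; rewrite lez_nat ME; move: K0; clear; nia.
have XM i := inM _ (bX i); have YM i := inM _ (bY i); have ZM i := inM _ (bZ i).
have pos22 : 0 <= avg (fun i => avg (fun j => G (Z i - Z j) (Z i - Z j))).
  by apply: (avg_gram_ge0 hG).
have := psd_two_families hG kappa 0 0 _ _ _ _ _ _ XM YM ZM ZM.
rewrite hyp normr0 => /(_ isT isT).
have c4 : c <= 2 * rho by rewrite /c; lra.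
have G1 : kappa ^+ 2 * G 0 0 <= kappa ^+ 2 by rewrite ler_piMr ?sqr_ge0 ?(hk_le1 hG).
move: (avg (fun j => G (Z j - 0) (Z j - 0))) diag => D diag.
have D0 : - 3 * rho <= D by lra.
have kk : kappa * D >= - 3 * rho by nra.
have kr : kappa ^+ 2 = 30 * rho by rewrite /rho; lra.
rewrite mulrDr -!mulrA; lra.
Qed.

(** * Averaging over dilations *)

(** Pairs (s, s') with s s' = (B!)^L, where s runs over the products of powers
    t ^ e of the multipliers 1 <= t <= B with exponents e < L (with repetition):
    a box in the exponents, hence a Folner set for the dilation group.  Storing
    the cofactor s' keeps every point integral. *)
Fixpoint dilations (L B : nat) : seq (nat * nat) :=
  if B is B'.+1 then
    [seq (s.1 * B ^ e, s.2 * B ^ (L - e))%N | s <- dilations L B', e <- iota 0 L]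
  else [:: (1, 1)%N].

Lemma size_dilations L B : size (dilations L B) = (L ^ B)%N.
Proof. by elim: B => //= B IH; rewrite size_allpairs IH size_iota expnSr. Qed.

Lemma dilations_mul L B s : s \in dilations L B -> (s.1 * s.2 = B`! ^ L)%N.
Proof.
elim: B s => [|B IH] s /=; first by rewrite inE => /eqP -> /=; rewrite fact0 exp1n.
move=> /allpairsP[[t e] /= [/IH ht]]; rewrite mem_iota add0n => /andP[_ /ltnW le] -> /=.
rewrite mulnACA ht -expnD subnKC // factS expnMn mulnC //.
Qed.

Definition dilsum {R : realFieldType} (L B : nat) (h : int -> int -> R) (x y : int) : R :=
  \sum_(s <- dilations L B) h (s.1%:Z * x) (s.2%:Z * y).

Lemma dilsumS {R : realFieldType} (L B : nat) (h : int -> int -> R) (x y : int) :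
  dilsum L B.+1 h x y = \sum_(e < L)
    dilsum L B (fun a b => h ((B.+1 ^ e)%N%:Z * a) ((B.+1 ^ (L - e))%N%:Z * b)) x y.
Proof.
rewrite /dilsum /= big_allpairs_dep exchange_big -{1}[L]subn0 big_mkord.
apply: eq_bigr => e _; apply: eq_bigr => s _ /=.
by rewrite !PoszM; congr h; ring.
Qed.

(** Multiplying by m shifts one exponent by one, so in that direction the sum
    telescopes and only the two extreme exponents, out of L, survive. *)
Lemma dilsum_dil {R : realFieldType} (L B : nat) (h : int -> int -> R) (m : nat) (x y : int) :
  (forall a b, 0 <= h a b <= 1) -> (0 < m <= B)%N ->
  `|dilsum L B h (m%:Z * x) y - dilsum L B h x (m%:Z * y)| * L%:R
    <= (size (dilations L B))%:R.
Proof.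
elim: B h => [|B IH] h hh; first by case: m.
move=> /andP[m0]; rewrite leq_eqVlt => /orP[/eqP ->|mB]; last first.
  rewrite !dilsumS -sumrB.
  apply: le_trans (ler_wpM2r (ler0n _ _) (ler_norm_sum _ _ _)) _.
  rewrite mulr_suml.
  apply: le_trans (ler_sum _ (fun e _ => IH _ _ _)) _ => //.
    by rewrite m0.
  by rewrite sumr_const card_ord !size_dilations expnSr natrM mulr_natr.
(* The cofactor exponent is shifted by one, so that the two sums are the
   sums of a over 1, ..., L and over 0, ..., L - 1. *)
pose a e := dilsum L B (fun a b => h ((B.+1 ^ e)%N%:Z * a) ((B.+1 ^ (L.+1 - e))%N%:Z * b)) x y.
have -> : dilsum L B.+1 h (B.+1%:Z * x) y = \sum_(e < L) a e.+1.
  rewrite dilsumS; apply: eq_bigr => e _; apply: eq_bigr => s _.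
  by rewrite subSS expnSr PoszM; congr h; ring.
have -> : dilsum L B.+1 h x (B.+1%:Z * y) = \sum_(e < L) a e.
  rewrite dilsumS; apply: eq_bigr => e _; apply: eq_bigr => s _.
  by rewrite (subSn (ltnW (ltn_ord e))) expnSr !PoszM; congr h; ring.
rewrite -sumrB -(big_mkord xpredT (fun e => a e.+1 - a e)) telescope_sumr //.
have ha e : 0 <= a e <= (L ^ B)%:R.
  rewrite -size_dilations /a /dilsum; apply/andP; split.
    by apply: sumr_ge0 => s _; case/andP: (hh ((B.+1 ^ e)%N%:Z * (s.1%:Z * x)) ((B.+1 ^ (L.+1 - e))%N%:Z * (s.2%:Z * y))).
  rewrite -sum1_size natr_sum; apply: ler_sum => s _.
  by case/andP: (hh ((B.+1 ^ e)%N%:Z * (s.1%:Z * x)) ((B.+1 ^ (L.+1 - e))%N%:Z * (s.2%:Z * y))).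
rewrite size_dilations expnSr natrM ler_wpM2r //.
by rewrite ler_norml; have := ha L; have := ha 0%N; lra.
Qed.

(** Every property is stable under averaging over the dilations, and
    invariance is gained.  The box for positivity shrinks by the factor (B!)^L,
    the largest possible dilation. *)
Lemma dilation_average {R : realFieldType} (kappa : R) (L M B : nat) (h : int -> int -> R) :
  0 <= kappa <= 1 -> (0 < L)%N ->
  (forall x y, 0 <= h x y <= 1) -> h 0 0 = 1 ->
  (forall x y, h (- x) (- y) = h x y) ->
  (forall (I : finType) (c : I -> R) (x y : I -> int),
    (forall i, `|x i| <= (B`! ^ L * M)%N%:Z) -> (forall i, `|y i| <= (B`! ^ L * M)%N%:Z) ->
    0 <= \sum_i \sum_j c i * c j * (h (x i - x j) (y i - y j) - kappa)) ->
  hyperbolic_kernel L%:R^-1 M B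
    (fun x y => dilsum L B h x y / (size (dilations L B))%:R - kappa).
Proof.
move=> /andP[k0 k1] L0 h01 h1 hN hpsd.
have S0 : 0 < (size (dilations L B))%:R :> R by rewrite ltr0n size_dilations expn_gt0 L0.
have mean0 : dilsum L B h 0 0 / (size (dilations L B))%:R = 1.
  rewrite /dilsum; under eq_bigr do rewrite !mulr0 h1.
  by rewrite -[1]/(1%:R) -natr_sum sum1_size mulfV ?gt_eqF.
have mean x y : 0 <= dilsum L B h x y / (size (dilations L B))%:R <= 1.
  rewrite divr_ge0 ?ler0n /= ?sumr_ge0 // => [|s _]; last by case/andP: (h01 (s.1%:Z * x) (s.2%:Z * y)).
  rewrite ler_pdivrMr // mul1r -sum1_size natr_sum; apply: ler_sum => s _.
  by case/andP: (h01 (s.1%:Z * x) (s.2%:Z * y)).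
split.
- by move=> x y; have := mean x y; lra.
- by move=> x y; rewrite mean0; have := mean x y; lra.
- by rewrite mean0; lra.
- move=> x y; congr (_ / _ - _); apply: eq_bigr => s _.
  by rewrite !mulrN hN.
- move=> m x y hm; have := dilsum_dil L B h m x y h01 hm.
  set T := dilsum _ _ _ _ _; set T' := dilsum _ _ _ _ _ => hT.
  have -> : T / (size (dilations L B))%:R - kappa - (T' / (size (dilations L B))%:R - kappa)
            = (T - T') / (size (dilations L B))%:R by ring.
  rewrite normrM (gtr0_norm (x := _^-1)) ?invr_gt0 // ler_pdivrMr // mulrC.
  by rewrite ler_pdivlMr ?ltr0n.
- move=> I c x y hx hy.
  have -> : \sum_i \sum_j c i * c j * (dilsum L B h (x i - x j) (y i - y j) /
      (size (dilations L B))%:R - kappa) =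
    (\sum_(s <- dilations L B) \sum_i \sum_j c i * c j *
      (h (s.1%:Z * x i - s.1%:Z * x j) (s.2%:Z * y i - s.2%:Z * y j) - kappa))
      / (size (dilations L B))%:R.
    rewrite [X in _ = X / _]exchange_big mulr_suml; apply: eq_bigr => i _.
    rewrite [X in _ = X / _]exchange_big mulr_suml; apply: eq_bigr => j _.
    have ksum : \sum_(s <- dilations L B) kappa = kappa * (size (dilations L B))%:R.
      by rewrite big_const_seq count_predT iter_addr_0 -[kappa *+ _]mulr_natr.
    rewrite -mulr_sumr sumrB ksum -[RHS]mulrA mulrBl mulfK ?gt_eqF //.
    congr (_ * (_ / _ - _)).
    by apply: eq_bigr => s _; rewrite !mulrBr.
  rewrite divr_ge0 ?ler0n // big_seq sumr_ge0 // => s /dilations_mul hs.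
  have /andP[s1 s2] : (0 < s.1)%N && (0 < s.2)%N.
    by rewrite -muln_gt0 hs expn_gt0 fact_gt0.
  apply: (hpsd I c (fun i => s.1%:Z * x i) (fun i => s.2%:Z * y i)) => i;
    rewrite normrM PoszM ler_pM //= lez_nat -hs ?leq_pmulr ?leq_pmull //.
Qed.

(** * Autocorrelation of a finite set *)

Definition corr {R : realFieldType} {T : zmodType} (A : seq T) (p : T) : R :=
  \sum_(u <- A) (u - p \in A)%:R.

(** Substitute w = u + p'.  This symmetric form exhibits the autocorrelation
    as a Gram kernel. *)
Lemma corr_shift {R : realFieldType} {T : zmodType} (A W : seq T) (p p' : T) :
  uniq A -> uniq W -> (forall u, u \in A -> u + p' \in W) ->
  corr A (p - p') = \sum_(w <- W) (w - p \in A)%:R * (w - p' \in A)%:R :> R.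
Proof.
move=> uA uW sub.
have E : perm_eq [seq w <- W | w - p' \in A] [seq u + p' | u <- A].
  apply: uniq_perm; rewrite ?filter_uniq ?map_inj_uniq //; first exact: addIr.
  move=> w; rewrite mem_filter; apply/andP/mapP => [[wA _]|[u uA' ->]].
    by exists (w - p') => //; rewrite subrK.
  by rewrite addrK; split=> //; apply: sub.
transitivity (\sum_(w <- [seq w <- W | w - p' \in A]) (w - p \in A)%:R : R); last first.
  rewrite big_filter big_mkcond; apply: eq_bigr => w _.
  by case: (w - p' \in A); rewrite ?mulr1 ?mulr0.
rewrite (perm_big _ E) big_map; apply: eq_bigr => u _.
by rewrite opprB addrA addrAC.
Qed.

Lemma corr0 {R : realFieldType} {T : zmodType} (A : seq T) :
  corr A 0 = (size A)%:R :> R.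
Proof.
rewrite /corr -sum1_size natr_sum big_seq [RHS]big_seq.
by apply: eq_bigr => u uA; rewrite subr0 uA.
Qed.

Lemma corr_bounds {R : realFieldType} {T : zmodType} (A : seq T) (p : T) :
  0 <= (corr A p : R) <= (size A)%:R.
Proof.
rewrite /corr sumr_ge0 //= -sum1_size natr_sum; apply: ler_sum => u _.
by rewrite lern1 leq_b1.
Qed.

Lemma corrN {R : realFieldType} {T : zmodType} (A : seq T) (p : T) :
  uniq A -> corr A (- p) = corr A p :> R.
Proof.
move=> uA; pose W := undup (A ++ [seq u + p | u <- A]).
have WA u : u \in A -> u + 0 \in W by move=> h; rewrite addr0 mem_undup mem_cat h.
have WAp u : u \in A -> u + p \in W.
  by move=> h; rewrite mem_undup mem_cat; apply/orP; right; apply/mapP; exists u.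
rewrite -[- p]sub0r (corr_shift A W) ?undup_uniq //.
rewrite -[in RHS](subr0 p) [RHS](corr_shift A W) ?undup_uniq //.
by apply: eq_bigr => w _; rewrite mulrC.
Qed.

Lemma sum_sqr_ge {R : realFieldType} {T : eqType} (W : seq T) (f : T -> R) :
  (\sum_(w <- W) f w) ^+ 2 <= (size W)%:R * \sum_(w <- W) f w ^+ 2.
Proof.
case: (posnP (size W)) => [/size0nil ->|W0]; first by rewrite !big_nil expr0n mulr0.
have N0 : 0 < (size W)%:R :> R by rewrite ltr0n.
set N := (size W)%:R in N0 *; set S := \sum_(w <- W) f w.
have : 0 <= \sum_(w <- W) (N * f w - S) ^+ 2 by apply: sumr_ge0 => w _; apply: sqr_ge0.
have -> : \sum_(w <- W) (N * f w - S) ^+ 2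
    = N * (N * (\sum_(w <- W) f w ^+ 2) - S ^+ 2).
  transitivity (\sum_(w <- W) (N ^+ 2 * f w ^+ 2 + (- 2 * N * S) * f w + S ^+ 2)).
    by apply: eq_bigr => w _; ring.
  rewrite !big_split /= -!mulr_sumr -/S big_const_seq count_predT iter_addr_0.
  by rewrite -[S *+ _]mulr_natr -/N; ring.
by rewrite pmulr_rge0 // subr_ge0.
Qed.

(** Cauchy-Schwarz on W for the function w |-> sum_i c_i 1_A (w - p_i), whose
    sum over W is (sum_i c_i) |A|. *)
Lemma corr_psd {R : realFieldType} {T : zmodType} (A W : seq T) (I : finType)
    (c : I -> R) (p : I -> T) :
  uniq A -> uniq W -> (forall i u, u \in A -> u + p i \in W) ->
  (\sum_i c i) ^+ 2 * (size A)%:R ^+ 2 <=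
    (size W)%:R * \sum_i \sum_j c i * c j * corr A (p i - p j).
Proof.
move=> uA uW sub.
pose f w := \sum_i c i * (w - p i \in A)%:R.
rewrite -exprMn.
have <- : \sum_(w <- W) f w = (\sum_i c i) * (size A)%:R.
  rewrite exchange_big mulr_suml; apply: eq_bigr => i _; rewrite -mulr_sumr -corr0.
  congr (_ * _); rewrite -(subrr (p i)) (corr_shift A W) //; last exact: sub.
  by apply: eq_bigr => w _; case: (_ \in _); rewrite ?mulr1 ?mulr0.
apply: le_trans (sum_sqr_ge W f) _; rewrite ler_wpM2l // le_eqVlt; apply/orP; left; apply/eqP.
under [RHS]eq_bigr => i _ do under eq_bigr => j _ do rewrite (corr_shift A W (p i) (p j) uA uW (sub j)) mulr_sumr.
under [RHS]eq_bigr => i _ do rewrite exchange_big.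
rewrite exchange_big; apply: eq_bigr => w _.
rewrite expr2 /f mulr_suml; apply: eq_bigr => i _; rewrite mulr_sumr; apply: eq_bigr => j _.
by ring.
Qed.

(** * Dense sets in boxes *)

Definition box_seq (N : nat) (z : int * int) : seq (int * int) :=
  [seq z + (i%:Z - N%:Z, j%:Z - N%:Z) | i <- iota 0 (2 * N + 1), j <- iota 0 (2 * N + 1)].

Lemma size_box_seq N z : size (box_seq N z) = ((2 * N + 1) ^ 2)%N.
Proof. by rewrite size_allpairs size_iota expnS expn1. Qed.

Lemma uniq_box_seq N z : uniq (box_seq N z).
Proof.
apply: allpairs_uniq; rewrite ?iota_uniq // => -[i j] [i' j'] _ _ /= /addrI[].
by move=> /addIr[->] /addIr[->].
Qed.

Lemma mem_box_seq N z w : (w \in box_seq N z) =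
  (`|w.1 - z.1| <= N%:Z) && (`|w.2 - z.2| <= N%:Z).
Proof.
apply/allpairsP/andP => [[[i j] /= [hi hj ->]]|[h1 h2]].
  by move: hi hj; rewrite !mem_iota /=; split; lia.
case: w z h1 h2 => [a b] [a' b'] /= h1 h2.
exists (absz (a - a' + N%:Z)%R, absz (b - b' + N%:Z)%R); split => /=.
- by rewrite mem_iota; lia.
- by rewrite mem_iota; lia.
- by congr (_, _) => /=; lia.
Qed.

Lemma translate_box N z : translate z (square_box N) = [set` box_seq N z].
Proof.
apply/seteqP; split => w /=.
  case: z => a b [[v1 v2] [/= hv1 hv2] <-].
  by rewrite /= mem_box_seq /= ![_ + v1]addrC ![_ + v2]addrC !addrK !ler_norml hv1.
rewrite /= mem_box_seq => /andP[h1 h2]; exists (w - z); last by rewrite addrC subrK.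
by split; rewrite /= -ler_norml.
Qed.

Lemma box_sample (E : set (int * int)) N z : exists A : seq (int * int),
  [/\ uniq A, size A = box_count E N z, {subset A <= box_seq N z} &
      forall u, u \in A -> E u].
Proof.
have fin : finite_set (E `&` translate z (square_box N)).
  by apply: sub_finite_set (@subIsetr _ _ _) _; rewrite translate_box; apply: finite_seq.
exists (fset_set (E `&` translate z (square_box N))); split=> //; first exact: fset_uniq.
  by move=> u; rewrite in_fset_set // inE translate_box => -[].
by move=> u; rewrite in_fset_set // inE => -[].
Qed.

(** Otherwise all large boxes have relative counts at most delta / 2, and so
    has their limit.  If the sequence of suprema did not converge, its formal
    limit would be 0, which is excluded as well. *)
Lemma density_box (R : realType) (delta : R) (E : set (int * int)) (N0 : nat) :
  0 < delta -> delta <= upper_banach_density R E ->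
  exists N z, (N0 <= N)%N /\
    delta / 2 * ((2 * N + 1) ^ 2)%N%:R <= (box_count E N z)%:R :> R.
Proof.
move=> d0 hd; apply: contrapT => hno.
have small N z : (N0 <= N)%N ->
    (box_count E N z)%:R / ((2 * N + 1) ^ 2)%N%:R <= delta / 2 :> R.
  move=> hN; have S0 : 0 < ((2 * N + 1) ^ 2)%N%:R :> R by rewrite ltr0n expn_gt0 addn1.
  rewrite ler_pdivrMr // leNgt; apply/negP => /ltW h.
  by apply: hno; exists N, z.
move: hd; rewrite /upper_banach_density; set f := (fun N : nat => _).
have [cf|/dvgP ->] := pselect (cvgn f); last first.
  by move=> /(lt_le_trans d0); rewrite ltxx.
move=> hd.
have : limn f <= delta / 2.
  apply: limr_le => //; exists N0 => // N /= hN.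
  by apply: ge_sup; [exists ((box_count E N 0)%:R / ((2 * N + 1) ^ 2)%N%:R), 0|
    move=> _ [z _ <-]; apply: small].
by move/(le_trans hd); lra.
Qed.

(** All translates A + p_i lie in a box of radius N + M <= 2 N, which has at
    most four times as many points as the box that A fills with density
    delta / 2; this is where delta / 8 comes from. *)
Lemma dense_sample (R : realType) (delta kappa : R) (E : set (int * int)) (M : nat) :
  0 < delta -> kappa <= delta / 8 -> delta <= upper_banach_density R E ->
  exists A : seq (int * int), [/\ uniq A, (0 < size A)%N, forall u, u \in A -> E u &
    forall (I : finType) (c : I -> R) (p : I -> int * int),
      (forall i, `|(p i).1| <= M%:Z) -> (forall i, `|(p i).2| <= M%:Z) ->
      0 <= \sum_i \sum_j c i * c j * (corr A (p i - p j) / (size A)%:R - kappa)].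
Proof.
move=> d0 hk hd.
have [N [z [MN hN]]] := density_box R delta E M d0 hd.
have [A [uA sA AW AE]] := box_sample E N z.
rewrite -sA in hN.
set V := ((2 * N + 1) ^ 2)%N in hN.
have V0 : 0 < V%:R :> R by rewrite ltr0n expn_gt0 addn1.
have A0 : 0 < (size A)%:R :> R by apply: lt_le_trans hN; rewrite mulr_gt0 ?divr_gt0.
exists A; split=> //; first by rewrite -(ltr0n R).
move=> I c p hp1 hp2.
pose W := box_seq (N + M) z.
have sub i u : u \in A -> u + p i \in W.
  move=> /AW; rewrite !mem_box_seq /= => /andP[h1 h2].
  by have := hp1 i; have := hp2 i; lia.
have := @corr_psd R _ A W I c p uA (uniq_box_seq _ _) sub.
set S := \sum_i \sum_j _ => hS.
have sW : (size W)%:R <= 4 * V%:R :> R.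
  by rewrite size_box_seq -natrM ler_nat /V; nia.
have -> : \sum_i \sum_j c i * c j * (corr A (p i - p j) / (size A)%:R - kappa)
    = S / (size A)%:R - kappa * (\sum_i c i) ^+ 2.
  rewrite /S mulr_suml expr2 mulr_suml mulr_sumr -sumrB; apply: eq_bigr => i _.
  rewrite mulr_suml !mulr_sumr -sumrB; apply: eq_bigr => j _.
  by ring.
rewrite subr_ge0 ler_pdivlMr //.
have c0 := sqr_ge0 (\sum_i c i).
move: (\sum_i c i) c0 hS => C c0 hS.
have S0 : 0 <= S.
  have W0 : 0 < (size W)%:R :> R by rewrite ltr0n size_box_seq expn_gt0 addn1.
  by rewrite -(pmulr_rge0 _ W0); apply: le_trans hS; rewrite mulr_ge0 // sqr_ge0.
have {}hS : C ^+ 2 * (size A)%:R ^+ 2 <= 4 * V%:R * S.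
  by apply: le_trans hS _; rewrite ler_wpM2r.
have hV : 4 * V%:R * kappa <= (size A)%:R.
  by apply: le_trans hN; rewrite -subr_ge0 (_ : _ - _ = 4 * V%:R * (delta / 8 - kappa));
    [rewrite mulr_ge0 ?mulr_ge0 ?subr_ge0 // | field].
rewrite -(ler_pM2l (x := 4 * V%:R)) ?mulr_gt0 //; apply: le_trans hS.
rewrite [leLHS](_ : _ = 4 * V%:R * kappa * (C ^+ 2 * (size A)%:R)); last by ring.
rewrite [leRHS](_ : _ = (size A)%:R * (C ^+ 2 * (size A)%:R)); last by ring.
by rewrite ler_wpM2r // mulr_ge0.
Qed.

(** * Differences of squares represented by differences *)

Theorem corollary1p7 (R : realType) (delta : R) (hdelta : 0 < delta) :
  exists K : int, 1 <= K /\
    forall E : set (int * int), delta <= upper_banach_density R E ->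
      [set K * m | m in [set: int]] `<=`
      [set p.1 ^+ 2 - p.2 ^+ 2 | p in difference_set E].
Proof.
pose kappa := Num.min 1 (delta / 8).
have kappa01 : 0 < kappa <= 1.
  by rewrite lt_min ltr01 divr_gt0 //= ge_min lexx.
have kappa01' : 0 <= kappa <= 1 by case/andP: kappa01 => /ltW -> ->.
have [k [L [M [B [k0 L0 contra]]]]] := no_hyperbolic_kernel kappa kappa01.
pose Lam := (B`! ^ L)%N.
exists (4 * Lam * k)%N%:Z; split.
  by rewrite lez_nat !muln_gt0 k0 expn_gt0 fact_gt0.
move=> E hE _ [m _ <-]; apply: contrapT => hno.
pose phi (x y : int) : int * int := (x + m * y, m * y - x).
pose M' := (Lam * M * (1 + `|m|))%N.
have [A [uA A0 AE Apsd]] := @dense_sample R delta kappa E M' hdelta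
  (ltac:(by rewrite ge_min lexx orbT)) hE.
have AR0 : 0 < (size A)%:R :> R by rewrite ltr0n.
pose h x y : R := corr A (phi x y) / (size A)%:R.
have phiB x y x' y' : phi (x - x') (y - y') = phi x y - phi x' y'.
  by congr (_, _) => /=; ring.
have h01 x y : 0 <= h x y <= 1.
  have /andP[h1 h2] := @corr_bounds R _ A (phi x y).
  by rewrite divr_ge0 //= ler_pdivrMr // mul1r.
have h00 : h 0 0 = 1.
  by rewrite /h (_ : phi 0 0 = 0) ?corr0 ?mulfV ?gt_eqF //; congr (_, _) => /=; ring.
have hN x y : h (- x) (- y) = h x y.
  rewrite /h (_ : phi _ _ = - phi x y) ?corrN //.
  by congr (_, _) => /=; ring.
have bound x y : `|x| <= (Lam * M)%N%:Z -> `|y| <= (Lam * M)%N%:Z ->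
    `|(phi x y).1| <= M'%:Z /\ `|(phi x y).2| <= M'%:Z.
  have -> : M'%:Z = (Lam * M)%N%:Z + `|m| * (Lam * M)%N%:Z by rewrite /M'; lia.
  move=> hx hy; have hmy : `|m * y| <= `|m| * (Lam * M)%N%:Z by rewrite normrM ler_wpM2l.
  split=> /=; last rewrite addrC; first exact: le_trans (ler_normD _ _) (lerD hx hmy).
  by apply: le_trans (ler_normD _ _) _; rewrite normrN lerD.
apply: (contra _ (dilation_average kappa L M B h kappa01' L0 h01 h00 hN _)).
  move=> I c x y hx hy.
  have := Apsd I c (fun i => phi (x i) (y i))
    (fun i => (bound _ _ (hx i) (hy i)).1) (fun i => (bound _ _ (hx i) (hy i)).2).
  by under eq_bigr do under eq_bigr do rewrite -phiB.
(* On x y = k each term of the average vanishes: a nonzero autocorrelation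
   would provide a difference of E that represents K m. *)
move=> x y xy; rewrite /dilsum big_seq big1 ?mul0r ?sub0r // => s /dilations_mul hs.
rewrite /h /corr big_seq big1 ?mul0r // => u uA'.
case: (boolP (u - phi (s.1%:Z * x) (s.2%:Z * y) \in A)) => // vA; case: hno.
exists (phi (s.1%:Z * x) (s.2%:Z * y)).
  exists u; first exact: AE.
  by exists (u - phi (s.1%:Z * x) (s.2%:Z * y)); [exact: AE|rewrite subKr].
rewrite /= (_ : (4 * Lam * k)%N%:Z = 4 * (s.1%:Z * s.2%:Z) * (x * y)); first by ring.
by rewrite xy -PoszM hs -/Lam !PoszM.
Qed.
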